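(* For each prime power $q>5$ the group $L_2(q)$ admits a Beauville structure.
   Context: $L_2(q)=PSL_2(q)=SL_2(q)/\{\pm I\}$, where $SL_2(q)$ is the group of $2\times 2$ matrices of determinant $1$ over the finite field $F_q$ with $q$ elements. A (unmixed) Beauville structure for a finite group $G$ is a pair of triples $(x_i,y_i,z_i)$ ($i=1,2$) of elements of $G$, each of which generates $G$, of orders $(l_i,m_i,n_i)$ (i.e. $x_i,y_i,z_i$ have orders $l_i,m_i,n_i$ respectively), such that: (1) $x_iy_iz_i=1$ for each $i=1,2$; (2) $l_i^{-1}+m_i^{-1}+n_i^{-1}<1$ for each $i=1,2$; (3) no non-identity power of $x_1$, $y_1$ or $z_1$ is conjugate in $G$ to a power of $x_2$, $y_2$ or $z_2$. *)

(* Defs.v *)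
From HB Require Import structures.
From mathcomp Require Import all_boot all_order all_algebra all_fingroup.

Set Implicit Arguments.
Unset Strict Implicit.
Unset Printing Implicit Defensive.

Import GroupScope.

Definition SL2 (F : finFieldType) : {set {'GL_2[F]}} :=
  [set u | (\det (GLval u) == 1)%R].

Lemma SL2_group_set (F : finFieldType) : group_set (SL2 F).
Proof.
apply/group_setP; split=> [|u v]; rewrite !inE.
  by rewrite GL_1E det1.
by rewrite GL_MxE det_mulmx => /eqP-> /eqP->; rewrite GRing.mulr1.
Qed.

Canonical SL2_group (F : finFieldType) := Group (SL2_group_set F).

(* {I, -I}; a single element in characteristic 2 *)
Definition pmI (F : finFieldType) : {set {'GL_2[F]}} :=
  [set u | (GLval u == 1)%R || (GLval u == -1)%R].

Lemma pmI_group_set (F : finFieldType) : group_set (pmI F).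
Proof.
apply/group_setP; split=> [|u v]; rewrite !inE.
  by rewrite GL_1E eqxx.
rewrite GL_ME => /orP[]/eqP-> /orP[]/eqP->;
  by rewrite ?GRing.mulrNN ?GRing.mulr1 ?GRing.mul1r eqxx ?orbT.
Qed.

Canonical pmI_group (F : finFieldType) := Group (pmI_group_set F).

Lemma pmI_normal (F : finFieldType) : pmI F <| SL2 F.
Proof.
apply/andP; split.
  apply/subsetP=> u; rewrite !inE => /orP[]/eqP->; first by rewrite det1.
  by rewrite -GRing.scaleN1r detZ GRing.sqrrN GRing.expr1n GRing.mul1r det1.
apply: cents_norm; apply/centsP=> u _ v; rewrite inE => uv; apply: val_inj.
change (GLval (u * v) = GLval (v * u)); rewrite !GL_ME.
by case/orP: uv => /eqP->;
  rewrite ?GRing.mulrN1 ?GRing.mulN1r ?GRing.mulr1 ?GRing.mul1r.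
Qed.

Definition L2 (F : finFieldType) : {group coset_of (pmI F)} :=
  (SL2 F / pmI F)%G.

Definition hyperbolic_triple (gT : finGroupType) (G : {group gT})
    (x y z : gT) : Prop :=
  [/\ [/\ x \in G, y \in G & z \in G],
      <<[set x; y; z]>> = G :> {set gT},
      x * y * z = 1
    & ((#[x]%:R^-1 + #[y]%:R^-1 + #[z]%:R^-1 : rat) < 1)%R].

Definition beauville_structure (gT : finGroupType) (G : {group gT})
    (x1 y1 z1 x2 y2 z2 : gT) : Prop :=
  [/\ hyperbolic_triple G x1 y1 z1,
      hyperbolic_triple G x2 y2 z2
    & forall a b g : gT, forall i j : nat,
        a \in [set x1; y1; z1] -> b \in [set x2; y2; z2] -> g \in G ->
        a ^+ i != 1 -> (a ^+ i) ^ g != b ^+ j].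

Definition admits_beauville_structure (gT : finGroupType) (G : {group gT})
    : Prop :=
  exists x1 y1 z1 x2 y2 z2 : gT, beauville_structure G x1 y1 z1 x2 y2 z2.

(* Main.v *)
Require Import Defs.
From HB Require Import structures.
From mathcomp Require Import all_boot all_order all_algebra all_fingroup.
From mathcomp Require Import all_solvable all_field.
From mathcomp Require Import ring lra zify.

(** Modulo the scalars 1 and -1, an element of a nonsplit torus of [SL_2(q)] has order
    dividing [(q + 1) / d], and a unipotent element or an element of a split
    torus has order dividing [p (q - 1) / d], where [d = gcd(2, q - 1)].  These
    two numbers are coprime, so a triple of elements of the first kind and a
    triple of elements of the second kind never share conjugate nontrivial
    powers, and only generation and the orders have to be arranged.  The powers
    of a nonscalar matrix of determinant 1 that are scalar are determined by its
    trace ([order_coset_trace]), so the orders are read off the traces of [x],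
    [y] and [x y].

    Split triple.  Take [y = diag(a, 1/a)] with [a] a generator of [F^*] and [x]
    unipotent with fixed point 1 on the projective line; the remaining parameter
    of [x] gives [x y] trace [-2] if [p] is odd (so that [- x y] is unipotent),
    and the trace of [y ^ 2] if [p = 2].  With these choices some [y ^ -i x]
    or [y ^ -i x ^ -1] sends infinity to 1, so the group generated contains a
    nontrivial unipotent fixing infinity; conjugating it by the torus
    multiplies its entry by squares, and differences of squares fill [F].
    Since [x] moves infinity, all transvections are obtained
    ([SL_gen_torus_unip]).

    Nonsplit triple.  Let [L] be the quadratic extension of [F], with Frobenius
    [e => e ^ q].  Over [L] the group [SL_2(F)] is conjugate to the group of
    matrices [(a, b; b^q, a^q)] of determinant 1.  Let [th] in [L] have norm
    [-1] and square [om] of order [q + 1]; take [y = diag(om, 1/om)] and [x] of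
    the same trace with [x y] of the opposite trace.  Let [H] be generated by
    [x] and [y].  The double coset of [g] modulo [<y>] remembers the norm of the
    upper left entry of [g].  For the words [x y^i x^-1] and [x y^i x] this norm
    is [nu^2 + (nu - 1)^2 - nu (nu - 1) (om^k + om^-k)] with [k = 2 i] and
    [k = 2 i - 1] respectively, so about [q / 2] values occur; with another
    choice of [x] the two families may have the same values.  Counting the
    elements of the double cosets gives [4 |H| > |SL_2(q)|]
    ([nonsplit_index_le3]).  A subgroup of index at most 3 contains the sixth
    power of every element, and sixth powers generate [SL_2(q)] when [q > 5]
    ([SL_expg6]). *)

Set Implicit Arguments.
Unset Strict Implicit.
Unset Printing Implicit Defensive.

Import Order.TTheory GroupScope GRing.Theory Num.Theory.
Local Open Scope ring_scope.

(** * Two by two matrices *)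
Definition mx2 (R : pzRingType) (a b c d : R) : 'M[R]_2 :=
  \matrix_(i, j) if i == 0 then (if j == 0 then a else b)
                 else (if j == 0 then c else d).

Section Matrices2.
Variable R : comNzRingType.
Implicit Types (a b c d : R) (A : 'M[R]_2).

Lemma mx2P A : A = mx2 (A 0 0) (A 0 1) (A 1 0) (A 1 1).
Proof.
apply/matrixP=> -[[|[|//]] hi] [[|[|//]] hj].
all: by rewrite !mxE /=; congr (A _ _); apply: val_inj.
Qed.

Lemma mx2_entries (P : R -> Prop) A :
  P (A 0 0) -> P (A 0 1) -> P (A 1 0) -> P (A 1 1) -> forall i j, P (A i j).
Proof.
move=> P00 P01 P10 P11 i j; rewrite (mx2P A) mxE.
by case: (i == 0); case: (j == 0).
Qed.

Lemma mx2_inj a b c d a' b' c' d' : mx2 a b c d = mx2 a' b' c' d' ->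
  [/\ a = a', b = b', c = c' & d = d'].
Proof.
move=> /matrixP e; split.
- by have := e 0 0; rewrite !mxE.
- by have := e 0 1; rewrite !mxE.
- by have := e 1 0; rewrite !mxE.
- by have := e 1 1; rewrite !mxE.
Qed.

Lemma mul_mx2 a b c d a' b' c' d' :
  mx2 a b c d *m mx2 a' b' c' d' =
  mx2 (a * a' + b * c') (a * b' + b * d') (c * a' + d * c') (c * b' + d * d').
Proof.
by rewrite [LHS]mx2P; congr mx2; rewrite !mxE !big_ord_recl big_ord0 !mxE /= addr0.
Qed.

Lemma det_mx2 a b c d : \det (mx2 a b c d) = a * d - b * c.
Proof.
by rewrite (expand_det_row _ 0) !big_ord_recl big_ord0 /cofactor !det_mx11 !mxE /=; ring.
Qed.

Lemma tr_mx2 a b c d : \tr (mx2 a b c d) = a + d.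
Proof. by rewrite /mxtrace !big_ord_recl big_ord0 !mxE /= addr0. Qed.

Lemma scalar_mx2 a : a%:M = mx2 a 0 0 a.
Proof. by rewrite [LHS]mx2P !mxE /= !mulr1n !mulr0n. Qed.

Lemma add_mx2 a b c d a' b' c' d' :
  mx2 a b c d + mx2 a' b' c' d' = mx2 (a + a') (b + b') (c + c') (d + d').
Proof. by rewrite [LHS]mx2P !mxE. Qed.

Lemma opp_mx2 a b c d : - mx2 a b c d = mx2 (- a) (- b) (- c) (- d).
Proof. by rewrite [LHS]mx2P !mxE. Qed.

Lemma scale_mx2 k a b c d : k *: mx2 a b c d = mx2 (k * a) (k * b) (k * c) (k * d).
Proof. by rewrite [LHS]mx2P !mxE. Qed.

Lemma sqr_mx2 A : \det A = 1 -> A * A = \tr A *: A - 1%:M.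
Proof.
rewrite (mx2P A) det_mx2 tr_mx2 scalar_mx2 scale_mx2 opp_mx2 add_mx2 -mulmxE mul_mx2 => <-.
by congr mx2; ring.
Qed.

(** By Cayley-Hamilton, [A ^+ n] is a combination of [A] and the identity whose
    coefficients depend on the trace alone. *)
Lemma expr_mx2 (t : R) n : exists u v : R, forall A, \det A = 1 -> \tr A = t ->
  A ^+ n = u *: A + v%:M.
Proof.
elim: n => [|n [u [v uvP]]].
  by exists 0, 1 => A _ _; rewrite scale0r add0r expr0.
exists (u * t + v), (- u) => A detA trA.
rewrite exprS uvP // mulrDr -scalerAr sqr_mx2 // trA scalerBr scalerA.
rewrite -mulmxE mul_mx_scalar scalerDl raddfN /= scalemx1 -!addrA; congr (_ + _).
by rewrite addrC.
Qed.

End Matrices2.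

Section Powers.
Variable F : fieldType.
Implicit Types (A B : 'M[F]_2).

Lemma scalar_comb A (u v c : F) : ~~ is_scalar_mx A ->
  (u *: A + v%:M == c%:M) = (u == 0) && (v == c).
Proof.
move=> nsA; have [->|u0] /= := eqVneq u 0.
  rewrite scale0r add0r; apply/eqP/eqP => [/matrixP/(_ 0 0)|-> //].
  by rewrite !mxE !mulr1n.
apply: contraNF nsA => /eqP e; apply/is_scalar_mxP; exists (u^-1 * (c - v)).
by rewrite -scale_scalar_mx raddfB /= -e addrK scalerA mulVf // scale1r.
Qed.

(** When [A] is not scalar, [u A + v] is scalar only for [u = 0], a condition
    that no longer mentions [A]. *)
Lemma exp_scalar_trace A B n c : \det A = 1 -> \det B = 1 -> \tr A = \tr B ->
  ~~ is_scalar_mx A -> ~~ is_scalar_mx B ->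
  (A ^+ n == c%:M) = (B ^+ n == c%:M).
Proof.
move=> dA dB tAB nA nB; have [u [v uvP]] := expr_mx2 (\tr B) n.
by rewrite !uvP // !scalar_comb.
Qed.

Lemma scalar_mx2E (a b c d : F) : is_scalar_mx (mx2 a b c d) = [&& b == 0, c == 0 & a == d].
Proof.
apply/is_scalar_mxP/and3P => [[k]|[/eqP-> /eqP-> /eqP->]].
  by rewrite scalar_mx2 => /mx2_inj[-> -> -> ->]; rewrite !eqxx.
by exists d; rewrite scalar_mx2.
Qed.
End Powers.

(** * Elements of the special linear group *)
Lemma coset_expg_eq1 (gT : finGroupType) (H : {group gT}) (g : gT) n :
  g \in 'N(H) -> ((coset H g ^+ n)%g == 1%g) = ((g ^+ n)%g \in H).
Proof.
move=> nHg; rewrite -morphX //; apply/eqP/idP => h; last exact: coset_id.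
by apply: coset_idr => //; rewrite groupX.
Qed.

Section SpecialLinear.
Variable F : finFieldType.
Local Notation SL := (SL2 F).
Local Notation Z := (pmI F).
Implicit Types (A B : 'M[F]_2) (g h : {'GL_2[F]}).

(** A total map, so that elements can be written as matrices; it is meaningful
    on invertible matrices and used on those of determinant 1. *)
Definition glmx A : {'GL_2[F]} := insubd (1%g : {'GL_2[F]}) A.

Lemma glmxE A : \det A = 1 -> GLval (glmx A) = A.
Proof.
move=> dA; rewrite /glmx; apply: (@insubdK _ _ {'GL_2[F]}).
by rewrite unfold_in /= unitmxE dA unitr1.
Qed.

Lemma glmx_SL A : \det A = 1 -> glmx A \in SL.
Proof. by move=> dA; rewrite inE glmxE // dA. Qed.

Lemma GLval_inj g h : GLval g = GLval h -> g = h.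
Proof. exact: val_inj. Qed.

Lemma SL_det g : g \in SL -> \det (GLval g) = 1.
Proof. by rewrite inE => /eqP. Qed.

Lemma GLvalX g n : GLval (g ^+ n)%g = GLval g ^+ n.
Proof. exact: FinRing.val_unitX. Qed.

Lemma SL_norm g : g \in SL -> g \in 'N(Z).
Proof. by move/(subsetP (normal_norm (pmI_normal F))). Qed.

Lemma coset_expr_eq1 g n : g \in SL ->
  ((coset Z g ^+ n)%g == 1%g) = (GLval g ^+ n == 1) || (GLval g ^+ n == -1).
Proof.
move=> /SL_norm nZ; have -> := @coset_expg_eq1 _ (pmI_group F) g n nZ.
by rewrite inE GLvalX.
Qed.


Definition upper (s : F) : {'GL_2[F]} := glmx (mx2 1 s 0 1).
Definition lower (s : F) : {'GL_2[F]} := glmx (mx2 1 0 s 1).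
Definition diagonal (a : F) : {'GL_2[F]} := glmx (mx2 a 0 0 a^-1).

Lemma upperE s : GLval (upper s) = mx2 1 s 0 1.
Proof. by rewrite glmxE // det_mx2; ring. Qed.

Lemma lowerE s : GLval (lower s) = mx2 1 0 s 1.
Proof. by rewrite glmxE // det_mx2; ring. Qed.

Lemma det_diagonal (a : F) : a != 0 -> \det (mx2 a 0 0 a^-1) = 1.
Proof. by move=> a0; rewrite det_mx2 mulfV // mulr0 subr0. Qed.

Lemma diagonalE a : a != 0 -> GLval (diagonal a) = mx2 a 0 0 a^-1.
Proof. by move=> a0; rewrite glmxE // det_diagonal. Qed.

Lemma diagonal_SL a : a != 0 -> diagonal a \in SL.
Proof. by move=> a0; rewrite glmx_SL // det_diagonal. Qed.

Lemma upperD s r : upper (s + r) = (upper s * upper r)%g.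
Proof.
apply: GLval_inj; rewrite GL_MxE !upperE mul_mx2.
by congr mx2; ring.
Qed.

Lemma upperN s : upper (- s) = ((upper s)^-1)%g.
Proof.
apply: (mulgI (upper s)); rewrite -upperD subrr mulgV; apply: GLval_inj.
by rewrite upperE GL_1E -scalar_mx2.
Qed.

Lemma diagonalX a i : a != 0 -> (diagonal a ^+ i)%g = diagonal (a ^+ i).
Proof.
move=> a0; elim: i => [|i IH].
  by apply: GLval_inj; rewrite expg0 GL_1E diagonalE ?expr0 ?oner_eq0 // invr1 -scalar_mx2.
apply: GLval_inj; rewrite expgS IH GL_MxE !diagonalE ?expf_neq0 // mul_mx2.
by rewrite !mulr0 !mul0r !addr0 !add0r exprS invfM.
Qed.

Lemma diagonalV a : a != 0 -> diagonal a^-1 = ((diagonal a)^-1)%g.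
Proof.
move=> a0; apply: (mulgI (diagonal a)); rewrite mulgV; apply: GLval_inj.
rewrite GL_MxE !diagonalE ?invr_eq0 // mul_mx2 GL_1E invrK.
by rewrite !mulr0 !mul0r !addr0 !add0r mulVf // mulfV // -scalar_mx2.
Qed.

End SpecialLinear.
Arguments glmx {F} A%_R.
Arguments upper {F} s%_R.
Arguments lower {F} s%_R.
Arguments diagonal {F} a%_R.

Section Membership.
Variables (F : finFieldType) (H : {group {'GL_2[F]}}).
Implicit Types x y : {'GL_2[F]}.

(** The closure properties of groups, for the group structure inferred from the
    type of invertible matrices: it is convertible to the generic one only at a
    high cost. *)
Lemma memGL_M x y : x \in H -> y \in H -> (x * y)%g \in H.
Proof. by move=> xH yH; have := @groupM _ H x y xH yH. Qed.

Lemma memGL_V x : x \in H -> (x^-1)%g \in H.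
Proof. by move=> xH; have := @groupVr _ H x xH. Qed.

Lemma memGL_X x n : x \in H -> (x ^+ n)%g \in H.
Proof.
move=> xH; elim: n => [|n IH]; first exact: group1.
by rewrite expgS memGL_M.
Qed.

Lemma memGL_J x y : x \in H -> y \in H -> (x ^ y)%g \in H.
Proof. by move=> xH yH; rewrite conjgE !memGL_M ?memGL_V. Qed.

End Membership.

(** * Generation by transvections *)
Section Transvections.
Variables (F : finFieldType) (H : {group {'GL_2[F]}}).
Implicit Types (g x : {'GL_2[F]}) (a s t r : F).

(** If the lower left entry [c] is nonzero, a matrix is an upper, a lower and an
    upper transvection; if [c = 0], multiplying by [lower 1] makes it nonzero. *)
Lemma SL_gen_transvections :
  (forall s, upper s \in H) -> (forall s, lower s \in H) -> SL2 F \subset H.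
Proof.
move=> upH loH; apply/subsetP => g gSL.
have lowerN0 (h : {'GL_2[F]}) : h \in SL2 F -> GLval h 1 0 != 0 -> h \in H.
  move=> hSL; have := SL_det hSL; rewrite (mx2P (GLval h)) => dh.
  set a := (h : 'M_2) 0 0 in dh *; set b := (h : 'M_2) 0 1 in dh *.
  set c := (h : 'M_2) 1 0 in dh *; set d := (h : 'M_2) 1 1 in dh *.
  rewrite mxE /= => c0.
  have -> : h = (upper ((a - 1) / c) * lower c * upper ((d - 1) / c))%g.
    apply: GLval_inj; rewrite !GL_MxE !upperE lowerE !mul_mx2.
    rewrite [LHS]mx2P -/a -/b -/c -/d; move: dh; rewrite det_mx2 => dh.
    have -> : b = (a * d - 1) / c by rewrite -dh; field.
    by congr mx2; field.
  by rewrite !memGL_M.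
have [c0|] := eqVneq (GLval g 1 0) 0; last exact: lowerN0.
have := SL_det gSL; rewrite (mx2P (GLval g)) c0 det_mx2 mulr0 subr0 => dg.
have a0 : GLval g 0 0 != 0.
  by apply/eqP => a0; move: dg; rewrite a0 mul0r => /esym/eqP; rewrite oner_eq0.
rewrite -(groupMl _ (loH 1)); apply: lowerN0.
  by rewrite memGL_M // glmx_SL // det_mx2; ring.
by rewrite GL_MxE lowerE (mx2P (GLval g)) c0 mul_mx2 mxE /= mul1r mulr0 addr0.
Qed.

(** The upper transvections act transitively on the affine line, so one element
    moving infinity allows to conjugate them into the stabiliser of 0. *)
Lemma SL_gen_upper x :
  (forall s, upper s \in H) -> x \in H -> x \in SL2 F -> GLval x 1 0 != 0 ->
  SL2 F \subset H.
Proof.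
move=> upH xH xSL c0; apply: SL_gen_transvections => // s.
have := SL_det xSL; rewrite (mx2P (GLval x)); move: c0.
set a := (x : 'M_2) 0 0; set b := (x : 'M_2) 0 1.
set c := (x : 'M_2) 1 0; set d := (x : 'M_2) 1 1.
rewrite det_mx2 => c0 dx.
pose w := (upper (- (a / c)) * x)%g; have wH : w \in H by rewrite memGL_M.
suff -> : lower s = (w * upper (- (s / c ^+ 2)) * w^-1)%g by rewrite !memGL_M ?memGL_V.
apply: (mulIg w); rewrite mulgKV; apply: GLval_inj.
rewrite !GL_MxE lowerE !upperE (mx2P (GLval x)) -/a -/b -/c -/d !mul_mx2.
have -> : b = (a * d - 1) / c by rewrite -dx; field.
by congr mx2; field.
Qed.

Lemma finField_sqr_char2 (c : F) : (2%:R : F) = 0 -> exists e, c = e ^+ 2.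
Proof.
move=> two0; have inj : injective (fun e : F => e ^+ 2).
  move=> e f /= ef; apply/eqP; rewrite -subr_eq0 -sqrf_eq0.
  have -> : (e - f) ^+ 2 = e ^+ 2 - f ^+ 2 + 2%:R * (f ^+ 2 - e * f) by ring.
  by rewrite ef two0 subrr mul0r addr0.
by have [g _ gK] := injF_bij inj; exists (g c); rewrite gK.
Qed.

(** For odd [q] every [c] is [((c + 1) / 2) ^ 2 - ((c - 1) / 2) ^ 2]; for even
    [q] it is itself a square. *)
Lemma upper_of_squares r : r != 0 ->
  (forall e, upper (e ^+ 2 * r) \in H) -> forall s, upper s \in H.
Proof.
move=> r0 sqH s; have [two0|two0] := eqVneq (2%:R : F) 0.
  have [e se] := finField_sqr_char2 (s / r) two0.
  by have := sqH e; rewrite -se divfK.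
have -> : s = ((s / r + 1) / 2%:R) ^+ 2 * r + - (((s / r - 1) / 2%:R) ^+ 2 * r).
  by field; rewrite r0 two0.
by rewrite upperD upperN memGL_M ?memGL_V.
Qed.

Lemma diagonal_conj_upper a s : a != 0 ->
  (diagonal a * upper s * (diagonal a)^-1)%g = upper (a ^+ 2 * s).
Proof.
move=> a0; apply: (mulIg (diagonal a)); rewrite mulgKV.
apply: GLval_inj; rewrite !GL_MxE !upperE diagonalE // !mul_mx2.
by congr mx2; field.
Qed.

Lemma upper_of_torus a r :
  a != 0 -> (forall e, e != 0 -> exists i, e = a ^+ i) ->
  diagonal a \in H -> r != 0 -> upper r \in H -> forall s, upper s \in H.
Proof.
move=> a0 agen daH r0 urH; apply: (upper_of_squares r0) => e.
have [->|/agen[i ->]] := eqVneq e 0.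
  have := memGL_V urH; rewrite -upperN => /(memGL_M urH).
  by rewrite -upperD subrr expr0n mul0r.
by rewrite -diagonal_conj_upper ?expf_neq0 // -diagonalX // !memGL_M ?memGL_V ?memGL_X.
Qed.

(** The unipotent matrices fixing the vector (1, 1). *)
Definition unip1 t : {'GL_2[F]} := glmx (mx2 (1 + t) (- t) t (1 - t)).

Lemma det_unip1 t : \det (mx2 (1 + t) (- t) t (1 - t)) = 1.
Proof. by rewrite det_mx2; ring. Qed.

Lemma unip1E t : GLval (unip1 t) = mx2 (1 + t) (- t) t (1 - t).
Proof. by rewrite glmxE ?det_unip1. Qed.

Lemma unip1_SL t : unip1 t \in SL2 F.
Proof. by rewrite glmx_SL ?det_unip1. Qed.

Lemma unip1D s t : unip1 (s + t) = (unip1 s * unip1 t)%g.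
Proof.
apply: GLval_inj; rewrite GL_MxE !unip1E mul_mx2.
by congr mx2; ring.
Qed.

Lemma unip1_0 : unip1 0 = 1%g.
Proof.
by apply: GLval_inj; rewrite unip1E GL_1E addr0 oppr0 addr0 -scalar_mx2.
Qed.

Lemma unip1V t : unip1 (- t) = ((unip1 t)^-1)%g.
Proof. by apply: (mulgI (unip1 t)); rewrite -unip1D subrr mulgV unip1_0. Qed.

Lemma unip1_memN t : unip1 t \in H -> unip1 (- t) \in H.
Proof. by rewrite unip1V; apply: memGL_V. Qed.

(** Up to scaling, [unip1 t] sends infinity to [1 + 1 / t] and the torus
    multiplies this by powers of [a ^ 2].  The hypothesis thus provides an
    element [w] sending infinity to 1, and conjugating [unip1 t] by [w] yields an
    upper transvection. *)
Lemma SL_gen_torus_unip a t i :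
  a != 0 -> (forall e, e != 0 -> exists i, e = a ^+ i) ->
  diagonal a \in H -> unip1 t \in H -> t != 0 -> 1 + t^-1 = a ^+ (2 * i) ->
  SL2 F \subset H.
Proof.
move=> a0 agen daH xH t0 ti.
apply: (@SL_gen_upper (unip1 t)) => //; first last.
- by rewrite unip1E mxE.
- exact: unip1_SL.
have ai0 : a ^+ i != 0 by rewrite expf_neq0.
pose w := ((diagonal a ^+ i)^-1 * unip1 t)%g.
have wH : w \in H by rewrite memGL_M ?memGL_V ?memGL_X.
apply: (upper_of_torus a0 agen daH (r := - (t^-1 / (a ^+ i) ^+ 2))).
  by rewrite oppr_eq0 mulf_neq0 ?invr_eq0 // expf_neq0.
suff -> : upper (- (t^-1 / (a ^+ i) ^+ 2)) = (unip1 t ^ w)%g by rewrite memGL_J.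
rewrite conjgE; apply: (mulgI w); rewrite mulKVg.
have dVE : GLval (diagonal a ^+ i)^-1%g = mx2 (a ^+ i)^-1 0 0 (a ^+ i).
  by rewrite diagonalX // -diagonalV // diagonalE ?invr_eq0 // invrK.
have tV : t = (a ^+ i ^+ 2 - 1)^-1 by rewrite -exprM mulnC -ti addrAC subrr add0r invrK.
have A0 : a ^+ i ^+ 2 - 1 != 0 by rewrite -invr_eq0 -tV.
apply: GLval_inj; rewrite !GL_MxE upperE dVE unip1E !mul_mx2 tV.
by congr mx2; field; rewrite ?ai0 ?A0 ?oner_eq0.
Qed.
End Transvections.

(** * Subgroups of small index *)
Lemma finField_generator (F : finFieldType) :
  exists a : F, [/\ a != 0, forall e, e != 0 -> exists i, e = a ^+ i
                  & forall n, (a ^+ n == 1) = (#|F|.-1 %| n)%N].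
Proof.
have /cyclicP[u uP] := field_unit_group_cyclic [set: {unit F}]%G.
have valX i : val (u ^+ i)%g = val u ^+ i by rewrite FinRing.val_unitX.
exists (val u); split.
- by have := valP u; rewrite unitfE.
- move=> e; rewrite -unitfE => eU.
  have /cycleP[i ei] : FinRing.unit F eU \in <[u]>%g by rewrite -uP inE.
  by exists i; rewrite -valX -ei.
move=> n; rewrite -valX -card_finField_unit uP -[#|_|]/#[u]%g order_dvdn.
by rewrite -(inj_eq val_inj).
Qed.

(** Among the cosets of [1, g, g^2, g^3] two coincide, so [H] contains [g], [g^2]
    or [g^3]. *)
Lemma index_le3_expg6 (gT : finGroupType) (G H : {group gT}) (g : gT) :
  (#|G : H| <= 3)%N -> g \in G -> (g ^+ 6)%g \in H.
Proof.
move=> iGH gG.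
pose f (i : 'I_4) := (H :* (g ^+ i))%g.
have /injectivePn[i [j nij fij]] : ~~ injectiveb f.
  apply/negP => /injectiveP fI.
  have : (#|[set f i | i in 'I_4]| <= #|G : H|)%N.
    apply/subset_leq_card/subsetP => _ /imsetP[i _ ->].
    by apply/rcosetsP; exists (g ^+ i)%g; rewrite ?groupX.
  by rewrite card_imset // card_ord => /leq_trans/(_ iGH).
wlog lij : i j nij fij / (i < j)%N.
  move=> W; case: (ltngtP i j) => [|lji|/val_inj eij]; first exact: W.
    by apply: (W j i) => //; rewrite eq_sym.
  by rewrite eij eqxx in nij.
have gH : (g ^+ (j - i))%g \in H.
  by rewrite expgnFr ?(ltnW lij) // -mem_rcoset -/(f i) fij rcoset_refl.
have /dvdnP[k ->] : (j - i %| 6)%N.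
  by move: (ltn_ord j) lij; case: (j : nat) (i : nat) => [|[|[|[|//]]]] [|[|[|]]].
by rewrite mulnC expgnA groupX.
Qed.

Section SmallIndex.
Variable F : finFieldType.

Lemma upperX (s : F) n : (upper s ^+ n)%g = upper (s *+ n).
Proof.
elim: n => [|n IH]; last by rewrite expgS IH -upperD mulrS.
by apply: GLval_inj; rewrite upperE GL_1E -scalar_mx2.
Qed.

Lemma upper_SL (s : F) : upper s \in SL2 F.
Proof. by rewrite glmx_SL // det_mx2; ring. Qed.

(** In characteristic at least 5 a transvection is a sixth power.  Otherwise it
    is the commutator of the sixth power of a diagonal matrix with a
    transvection. *)
Lemma upper_of_expg6 (H : {group {'GL_2[F]}}) :
  (6%:R != 0 :> F) || [exists a : F, (a != 0) && (a ^+ 12 != 1)] ->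
  (forall g, g \in SL2 F -> (g ^+ 6)%g \in H) -> forall s : F, upper s \in H.
Proof.
move=> /orP[n6|/existsP[a /andP[a0 a12]]] H6 s.
  have -> : s = (s / 6%:R) *+ 6 by rewrite -[RHS]mulr_natr divfK.
  by rewrite -upperX; apply/H6/upper_SL.
have a12' : a ^+ 12 - 1 != 0 by rewrite subr_eq0.
set r := s / (a ^+ 12 - 1).
have -> : upper s = ((diagonal a) ^+ 6 * ((diagonal a ^+ 6)^-1) ^ upper (- r))%g.
  rewrite conjgE upperN invgK !mulgA diagonalX // diagonal_conj_upper ?expf_neq0 //.
  by rewrite -upperN -upperD; congr upper; rewrite /r; field.
rewrite memGL_M ?H6 ?diagonal_SL //; rewrite -expVgn conjXg H6 //.
by rewrite memGL_J ?memGL_V ?diagonal_SL ?upper_SL.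
Qed.

(** The lower transvections are conjugate to the upper ones, and the hypothesis
    on [H] is invariant under conjugation. *)
Lemma SL_expg6 (H : {group {'GL_2[F]}}) :
  (6%:R != 0 :> F) || [exists a : F, (a != 0) && (a ^+ 12 != 1)] ->
  (forall g, g \in SL2 F -> (g ^+ 6)%g \in H) -> SL2 F \subset H.
Proof.
move=> hF H6; apply: SL_gen_transvections => s; first exact: upper_of_expg6.
have dJ : \det (mx2 0 1 (-1) 0) = 1 :> F by rewrite det_mx2; ring.
pose J : {'GL_2[F]} := glmx (mx2 0 1 (-1) 0).
have JSL : J \in SL2 F by rewrite glmx_SL.
have : upper (- s) \in (H :^ J)%G.
  apply: upper_of_expg6 => // g gSL; rewrite mem_conjg conjXg H6 //.
  by rewrite groupJ ?groupV.
rewrite mem_conjg; suff -> : (upper (- s) ^ J^-1 = lower s)%g by [].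
rewrite conjgE invgK mulgA; apply: (mulIg J); rewrite mulgKV; apply: GLval_inj.
by rewrite !GL_MxE upperE lowerE glmxE // !mul_mx2; congr mx2; ring.
Qed.

End SmallIndex.

(** * Orders and hyperbolic triples in the quotient *)
Lemma order_coset_invM (gT : finGroupType) (G H : {group gT}) (x y : gT) :
  H <| G -> x \in G -> y \in G ->
  #[(coset H x * coset H y)^-1]%g = #[coset H (x * y)%g]%g.
Proof.
move=> /normal_norm/subsetP nHG xG yG.
by rewrite orderV -morphM ?nHG.
Qed.

Lemma quotient_hyperbolic (gT : finGroupType) (G H : {group gT}) (x y : gT) :
  H <| G -> x \in G -> y \in G -> G \subset <<[set x; y]>>%g ->
  #[coset H x]%g%:R^-1 + #[coset H y]%g%:R^-1 + #[coset H (x * y)%g]%g%:R^-1 < 1 :> rat ->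
  hyperbolic_triple (G / H)%G (coset H x) (coset H y) (coset H x * coset H y)^-1%g.
Proof.
move=> nsHG xG yG gen ord.
have [xGH yGH] : (coset H x \in G / H /\ coset H y \in G / H)%g.
  by split; apply: mem_quotient.
have /subsetP nHG := normal_norm nsHG.
split.
- by split; rewrite // groupV groupM.
- apply/eqP; rewrite eqEsubset gen_subG; apply/andP; split.
    by apply/subsetP => g; rewrite !inE -orbA => /or3P[]/eqP->; rewrite // groupV groupM.
  apply: subset_trans (quotientS _ gen) _.
  rewrite quotient_gen ?genS // ?subUset ?sub1set ?nHG //.
  by rewrite quotientU !quotient_set1 ?nHG // subUset !sub1set !inE !eqxx ?orbT.
- by rewrite mulgV.
- by rewrite (order_coset_invM nsHG).
Qed.

Section Orders.
Variable F : finFieldType.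
Local Notation SL := (SL2 F).
Local Notation Z := (pmI F).
Implicit Types g h : {'GL_2[F]}.

Lemma order_coset_trace g h :
  g \in SL -> h \in SL ->
  ~~ is_scalar_mx (GLval g) -> ~~ is_scalar_mx (GLval h) ->
  \tr (GLval g) = \tr (GLval h) \/ \tr (GLval g) = - \tr (GLval h) ->
  #[coset Z g]%g = #[coset Z h]%g.
Proof.
move=> gSL hSL ng nh trgh.
have key n : ((coset Z g ^+ n)%g == 1%g) = ((coset Z h ^+ n)%g == 1%g).
  rewrite !coset_expr_eq1 //; have [dg dh] := (SL_det gSL, SL_det hSL).
  have m1 : -1 = (-1)%:M :> 'M[F]_2 by rewrite raddfN.
  case: trgh => trgh.
    by rewrite m1 !(exp_scalar_trace _ _ dg dh trgh ng nh).
  have dNh : \det (- GLval h) = 1 by rewrite -scaleN1r detZ dh; ring.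
  have nNh : ~~ is_scalar_mx (- GLval h).
    apply: contra nh => /is_scalar_mxP[c e]; apply/is_scalar_mxP.
    by exists (- c); rewrite raddfN /= -e opprK.
  have trNh : \tr (GLval g) = \tr (- GLval h) by rewrite raddfN.
  rewrite m1 !(exp_scalar_trace _ _ dg dNh trNh ng nNh) -m1 exprNn.
  rewrite -signr_odd; case: (odd n); rewrite ?expr0 ?mul1r // expr1 mulN1r.
  by rewrite eqr_opp orbC eqr_oppLR.
by apply/eqP; rewrite eqn_dvd !order_dvdn -key expg_order eqxx key expg_order eqxx.
Qed.

End Orders.

(** * The split triple *)
Lemma sum_inv_lt1 (a b c l m n : nat) :
  (a < l)%N -> (b < m)%N -> (c < n)%N ->
  a.+1%:R^-1 + b.+1%:R^-1 + c.+1%:R^-1 < 1 :> rat ->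
  l%:R^-1 + m%:R^-1 + n%:R^-1 < 1 :> rat.
Proof.
have inv_le (i j : nat) : (i < j)%N -> j%:R^-1 <= i.+1%:R^-1 :> rat.
  by move=> ij; rewrite lef_pV2 ?posrE ?ltr0n ?ler_nat // (leq_trans _ ij).
move=> /inv_le al /inv_le bm /inv_le cn; apply: le_lt_trans.
by rewrite !lerD.
Qed.

Lemma sum_inv_444 : 4%:R^-1 + 4%:R^-1 + 4%:R^-1 < 1 :> rat. Proof. by lra. Qed.
Lemma sum_inv_343 : 3%:R^-1 + 4%:R^-1 + 3%:R^-1 < 1 :> rat. Proof. by lra. Qed.
Lemma sum_inv_535 : 5%:R^-1 + 3%:R^-1 + 5%:R^-1 < 1 :> rat. Proof. by lra. Qed.
Lemma sum_inv_274 : 2%:R^-1 + 7%:R^-1 + 4%:R^-1 < 1 :> rat. Proof. by lra. Qed.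

Lemma odd_prime_ge5 p : prime p -> odd p -> p != 3%N -> (5 <= p)%N.
Proof. by case: p => [|[|[|[|[|p]]]]]. Qed.

Lemma prime_power3_ge9 k : (5 < 3 ^ k)%N -> (9 <= 3 ^ k)%N.
Proof.
case: k => [|[|k]] // _; rewrite !expnS mulnA.
by rewrite -[X in (X <= _)%N](muln1 9) leq_mul2l expn_gt0.
Qed.

Lemma prime_power2_ge8 k : (5 < 2 ^ k)%N -> (8 <= 2 ^ k)%N.
Proof.
case: k => [|[|[|k]]] // _; rewrite !expnS !mulnA.
by rewrite -[X in (X <= _)%N](muln1 8) leq_mul2l expn_gt0.
Qed.

(** [half_if_odd q (q - 1)] and [half_if_odd q (q + 1)] are the orders of the
    split and nonsplit maximal tori of [L_2(q)]. *)
Definition half_if_odd (q n : nat) : nat := if odd q then n./2 else n.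

Section SplitTriple.
Variables (F : finFieldType) (p k : nat).
Hypotheses (p_prime : prime p) (cardF : #|F| = (p ^ k)%N) (q_gt5 : (5 < #|F|)%N).
Local Notation SL := (SL2 F).
Local Notation Z := (pmI F).
Local Notation q := #|F|.

Lemma pcharFp : (p%:R : F) = 0.
Proof. by have := card_finPcharP cardF p_prime; rewrite inE => /andP[_ /eqP]. Qed.

Lemma card_gt0_exp : (0 < k)%N.
Proof. by move: q_gt5; rewrite cardF; case: k. Qed.

Lemma odd_card : odd q = odd p.
Proof. by rewrite cardF oddX eqn0Ngt card_gt0_exp. Qed.

Lemma coset_diagonal_expr (b : F) n : b != 0 ->
  ((coset Z (diagonal b) ^+ n)%g == 1%g) = (b ^+ n == 1) || (b ^+ n == -1).
Proof.
move=> b0; rewrite coset_expr_eq1 ?diagonal_SL //.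
rewrite -GLvalX diagonalX // diagonalE ?expf_neq0 //.
have key (c : F) : c * c = 1 -> (mx2 (b ^+ n) 0 0 (b ^- n) == c%:M) = (b ^+ n == c).
  move=> cc; rewrite scalar_mx2; apply/eqP/eqP => [/mx2_inj[]//|->].
  congr mx2; rewrite -[LHS]mulr1 -cc mulKf //.
  by apply: contraTneq (oner_neq0 F) => c0; rewrite -cc c0 mul0r eqxx.
have m1 : -1 = (-1)%:M :> 'M[F]_2 by rewrite raddfN.
by rewrite m1 !key ?mul1r // mulrNN mulr1.
Qed.

Lemma unip1X (t : F) n : (unip1 t ^+ n)%g = unip1 (t *+ n).
Proof. by elim: n => [|n IH]; rewrite ?unip1_0 // expgS IH -unip1D mulrS. Qed.

Lemma unip1_nonscalar (t : F) : t != 0 -> ~~ is_scalar_mx (GLval (unip1 t)).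
Proof. by move=> t0; rewrite unip1E scalar_mx2E oppr_eq0 (negPf t0). Qed.

Lemma order_coset_unip1 (t : F) : t != 0 -> #[coset Z (unip1 t)]%g = p.
Proof.
move=> t0; have xSL := unip1_SL t.
have : (#[coset Z (unip1 t)] %| p)%N.
  rewrite order_dvdn coset_expr_eq1 // -GLvalX unip1X -mulr_natr pcharFp mulr0.
  by rewrite unip1_0 GL_1E eqxx.
case/primeP: p_prime => _ /[apply] /orP[|/eqP//].
rewrite order_eq1 -[coset _ _]expg1 coset_expr_eq1 // expr1.
by case/orP=> /eqP e; have := unip1_nonscalar t0; rewrite e -?scaleN1r ?scalemx1 ?scalar_mx_is_scalar.
Qed.

Lemma tr_unip1_diagonal (t a : F) : a != 0 ->
  \tr (GLval (unip1 t * diagonal a)%g) = a + a^-1 + t * (a - a^-1).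
Proof.
by move=> a0; rewrite GL_MxE unip1E diagonalE // mul_mx2 tr_mx2; ring.
Qed.

Lemma unip1_diagonal_nonscalar (t a : F) : t != 0 -> a != 0 ->
  ~~ is_scalar_mx (GLval (unip1 t * diagonal a)%g).
Proof.
move=> t0 a0; rewrite GL_MxE unip1E diagonalE // mul_mx2 scalar_mx2E.
by rewrite !mulr0 !addr0 mulf_eq0 (negPf t0) (negPf a0) andbF.
Qed.

(** The parameter [t = (1 + a) / (1 - a)] gives [x y] trace [-2].  Then
    [1 + 1 / t] and [1 - 1 / t] have ratio [a], so one of them is an even power of
    [a], and [SL_gen_torus_unip] applies to [x] or to its inverse. *)
Lemma split_triple_odd : odd p -> exists x y : {'GL_2[F]},
  [/\ x \in SL /\ y \in SL, SL \subset <<[set x; y]>>%g,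
      #[coset Z x]%g%:R^-1 + #[coset Z y]%g%:R^-1 + #[coset Z (x * y)%g]%g%:R^-1 < 1 :> rat
    & [/\ #[coset Z x]%g %| p, #[coset Z y]%g %| q.-1./2 & #[coset Z (x * y)%g]%g %| p]%N].
Proof.
move=> p_odd; have q_odd : odd q by rewrite odd_card.
have two0 : (2%:R : F) != 0.
  apply/eqP => two0; have := card_finPcharP cardF p_prime.
  have two : 2%N \in [pchar F] by rewrite inE two0 eqxx.
  by rewrite (pcharf_eq two) inE => /eqP e2; rewrite e2 in p_odd.
have [a [a0 agen aord]] := finField_generator F.
have q1_even : (q.-1 = q.-1./2 * 2)%N.
  by rewrite muln2 even_halfK //; case: q q_odd.
have [q1_gt2 h_ge3] : (2 < q.-1 /\ 2 < q.-1./2)%N.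
  by move: q_odd q_gt5; move: q => n; clear; lia.
have aN1 : 1 - a != 0.
  rewrite subr_eq0 eq_sym; have := aord 1%N; rewrite expr1 => ->; rewrite dvdn1.
  by apply: contraTneq q1_gt2 => ->.
have aNm1 : 1 + a != 0.
  apply/eqP => e; have := aord 2%N.
  have -> : a = -1 by apply/eqP; rewrite -addr_eq0 addrC e.
  by rewrite sqrrN expr1n eqxx => /esym /(dvdn_leq (isT : (0 < 2)%N)); rewrite leqNgt q1_gt2.
pose t := (1 + a) / (1 - a); have t0 : t != 0 by rewrite mulf_neq0 ?invr_eq0.
pose x : {'GL_2[F]} := unip1 t; pose y : {'GL_2[F]} := diagonal a.
have xSL : x \in SL := unip1_SL t; have ySL : y \in SL by rewrite diagonal_SL.
have ox : #[coset Z x]%g = p by rewrite order_coset_unip1.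
have oz : #[coset Z (x * y)%g]%g = p.
  rewrite -ox; apply: order_coset_trace; rewrite ?groupM //.
  - exact: unip1_diagonal_nonscalar.
  - exact: unip1_nonscalar.
  right; rewrite tr_unip1_diagonal // unip1E tr_mx2 /t.
  by field; rewrite a0 aN1.
have oy : (#[coset Z y]%g %| q.-1./2)%N.
  rewrite order_dvdn coset_diagonal_expr // -eqf_sqr expr1n -exprM aord.
  by rewrite -q1_even.
have oy_ge : (q.-1./2 <= #[coset Z y]%g)%N.
  have := expg_order (coset Z y) => /eqP; rewrite coset_diagonal_expr //.
  rewrite -eqf_sqr expr1n -exprM aord {1}q1_even dvdn_pmul2r //.
  exact/dvdn_leq/order_gt0.
exists x, y; split=> //; last by rewrite ox oz.
  suff gen (H : {group {'GL_2[F]}}) : x \in H -> y \in H -> SL \subset H.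
    by apply: (gen <<[set x; y]>>%G); rewrite mem_gen // !inE eqxx ?orbT.
  move=> xH yH.
  have [i ci] : exists i, 2%:R / (1 + a) = a ^+ i.
    by apply: agen; rewrite mulf_neq0 ?invr_eq0.
  have [i_odd|i_even] := boolP (odd i); last first.
    apply: (@SL_gen_torus_unip _ H a t i./2) => //.
    rewrite mul2n even_halfK //.
    by rewrite -ci /t; field; rewrite aN1 aNm1.
  apply: (@SL_gen_torus_unip _ H a (- t) i.+1./2) => //; rewrite ?oppr_eq0 //.
    exact: unip1_memN.
  rewrite mul2n even_halfK ?oddS ?negbK //.
  by rewrite exprS -ci /t; field; rewrite ?oppr_eq0 ?mulf_neq0 ?aN1 ?aNm1 ?invr_eq0.
rewrite ox oz; have [p3|p3] := eqVneq p 3%N.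
  have q9 : (9 <= q)%N by move: q_gt5; rewrite cardF p3; apply: prime_power3_ge9.
  suff oy4 : (4 <= #[coset Z y]%g)%N.
    by rewrite p3; exact: (sum_inv_lt1 (leqnn 3) oy4 (leqnn 3) sum_inv_343).
  apply: leq_trans oy_ge; rewrite -leq_double -!muln2 -q1_even -ltnS prednK // (leq_trans _ q9) //.
have p5 : (5 <= p)%N by apply: odd_prime_ge5.
exact: (sum_inv_lt1 p5 (leq_trans h_ge3 oy_ge) p5 sum_inv_535).
Qed.

(** With [w = a + 1 / a] and [t = w + 1], the trace of [x y] is
    [w + t w = w ^ 2], the trace of [y ^ 2].  Every element of [F^*] is an even
    power of [a]. *)
Lemma split_triple_even : ~~ odd p -> exists x y : {'GL_2[F]},
  [/\ x \in SL /\ y \in SL, SL \subset <<[set x; y]>>%g,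
      #[coset Z x]%g%:R^-1 + #[coset Z y]%g%:R^-1 + #[coset Z (x * y)%g]%g%:R^-1 < 1 :> rat
    & [/\ #[coset Z x]%g %| p, #[coset Z y]%g %| q.-1 & #[coset Z (x * y)%g]%g %| q.-1]%N].
Proof.
move=> p_even; have p2 : p = 2%N by case/even_prime: p_prime => // e; rewrite e in p_even.
have q_even : ~~ odd q by rewrite odd_card.
have q_ge8 : (8 <= q)%N.
  by move: q_gt5; rewrite cardF p2; apply: prime_power2_ge8.
have q1_ge7 : (7 <= q.-1)%N by rewrite -ltnS prednK // (leq_trans _ q_ge8).
have two0 : (2%:R : F) = 0 by rewrite -pcharFp p2.
have opp (u : F) : - u = u.
  by apply/eqP; rewrite eq_sym -subr_eq0 opprK -mulr2n -mulr_natr two0 mulr0.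
have [a [a0 agen aord]] := finField_generator F.
have aordN n : (0 < n < q.-1)%N -> a ^+ n - 1 != 0.
  by case/andP=> n0 nq; rewrite subr_eq0 aord; apply/negP => /(dvdn_leq n0); rewrite leqNgt nq.
have [a2 a3 a4] : [/\ a ^+ 2 - 1 != 0, a ^+ 3 - 1 != 0 & a ^+ 4 - 1 != 0].
  by split; apply: aordN; apply: leq_trans q1_ge7.
pose w := a + a^-1; pose t := w + 1.
have w0 : w != 0.
  apply: contra a2 => /eqP w0; have -> : a ^+ 2 - 1 = a * w - 2%:R by rewrite /w; field.
  by rewrite w0 two0 mulr0 subrr.
have t0 : t != 0.
  apply: contra a3 => /eqP t0.
  have -> : a ^+ 3 - 1 = (a - 1) * a * t by rewrite /t /w; field.
  by rewrite t0 mulr0.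
pose x : {'GL_2[F]} := unip1 t; pose y : {'GL_2[F]} := diagonal a.
have xSL : x \in SL := unip1_SL t; have ySL : y \in SL by rewrite diagonal_SL.
have ox : #[coset Z x]%g = p by rewrite order_coset_unip1.
have oz : #[coset Z (x * y)%g]%g = #[coset Z (diagonal (a ^+ 2))]%g.
  apply: order_coset_trace; rewrite ?groupM ?diagonal_SL ?expf_neq0 //.
  - exact: unip1_diagonal_nonscalar.
  - rewrite diagonalE ?expf_neq0 // scalar_mx2E eqxx /=; apply: contra a4 => /eqP e.
    by rewrite subr_eq0 -[(4)%N]/(2 + 2)%N exprD {1}e mulVf ?expf_neq0.
  left; rewrite tr_unip1_diagonal // diagonalE ?expf_neq0 // tr_mx2 /t /w.
  have -> : a + a^-1 + (a + a^-1 + 1) * (a - a^-1) = a ^+ 2 + a ^- 2 + 2%:R * (a - a ^- 2) by field.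
  by rewrite two0 mul0r addr0.
have oy : (#[coset Z y]%g %| q.-1)%N.
  by rewrite order_dvdn coset_diagonal_expr // aord dvdnn.
have oz' : (#[coset Z (x * y)%g]%g %| q.-1)%N.
  by rewrite oz order_dvdn coset_diagonal_expr ?expf_neq0 // -exprM aord dvdn_mull.
have oy_ge : (7 <= #[coset Z y]%g)%N.
  have := expg_order (coset Z y) => /eqP; rewrite coset_diagonal_expr // opp orbb aord.
  by move=> /(dvdn_leq (order_gt0 _)); apply: leq_trans.
have oz_ge : (4 <= #[coset Z (x * y)%g]%g)%N.
  rewrite oz; set z := coset Z (diagonal (a ^+ 2)).
  have := expg_order z => /eqP; rewrite coset_diagonal_expr ?expf_neq0 // opp orbb -exprM aord.
  have n0 := order_gt0 z; move=> /dvdn_leq; rewrite muln_gt0 n0 => /(_ isT).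
  move: n0 q1_ge7; move: #[z]%g q => m n; clear; lia.
exists x, y; split=> //; last 1 first.
- by split; rewrite // ox.
- suff gen (H : {group {'GL_2[F]}}) : x \in H -> y \in H -> SL \subset H.
    by apply: (gen <<[set x; y]>>%G); rewrite mem_gen // !inE eqxx ?orbT.
  move=> xH yH.
  have [i ci] : exists i, 1 + t^-1 = a ^+ i.
    apply: agen; have -> : 1 + t^-1 = (w + 2%:R) / t by rewrite /t; field.
    by rewrite two0 addr0 mulf_neq0 ?invr_eq0.
  (* Since [q - 1] is odd, adding it to an odd exponent makes it even. *)
  pose j := if odd i then (i + q.-1)%N else i.
  apply: (@SL_gen_torus_unip _ H a t j./2) => //.
  have -> : (2 * j./2 = j)%N.
    rewrite mul2n even_halfK // /j; case: ifP => [i_odd|->//].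
    by rewrite oddD i_odd; case: q q_even q_gt5 => //= n; rewrite negbK => ->.
  rewrite ci /j; case: ifP => // _; rewrite exprD.
  by have /eqP-> : a ^+ q.-1 == 1; rewrite ?mulr1 // aord.
by rewrite ox p2; exact: (sum_inv_lt1 (leqnn 2) oy_ge oz_ge sum_inv_274).
Qed.

End SplitTriple.

(** * The quadratic extension *)

(** The map [x => x ^ 2 - x] identifies 0 and 1, hence is not surjective, and
    [X ^ 2 - X - c] has no root when [c] is not a value. *)
Lemma exists_irreducible_quadratic (F : finFieldType) :
  exists h : {poly F}, [/\ size h = 3%N, h \is monic & irreducible_poly h].
Proof.
pose f (x : F) := x ^+ 2 - x.
have /forallPn[c cf] : ~~ [forall c, c \in codom f].
  apply/negP => /forallP fsurj.
  have /injectiveP finj : injectiveb f.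
    apply: (@leq_size_uniq F (enum F) (codom f) (enum_uniq F)).
      by move=> y _; apply: fsurj.
    by rewrite size_codom cardE.
  have : f 0 = f 1 by rewrite /f; ring.
  by move/finj/esym/eqP; rewrite oner_eq0.
pose h : {poly F} := 'X^2 - 'X - c%:P.
have sz : size h = 3%N.
  rewrite /h -addrA size_polyDl ?size_polyXn // -opprD size_polyN.
  by rewrite size_polyDl ?size_polyX // (leq_ltn_trans (size_polyC_leq1 _)).
exists h; split => //.
  rewrite monicE /lead_coef sz /h !coefE /=.
  by rewrite !subr0.
apply: cubic_irreducible; first by rewrite sz.
move=> x; apply: contra cf; rewrite /root /h !hornerE subr_eq0 => /eqP <-.
by apply/codomP; exists x.
Qed.

Lemma quadratic_extension (F : finFieldType) :
  exists (L : finFieldType) (iota : {rmorphism F -> L}), #|L| = (#|F| ^ 2)%N.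
Proof.
have [h [sz hm hi]] := exists_irreducible_quadratic F.
pose hI : monic_irreducible_poly h := (hi, hm).
exists ({poly %/ h with hI} : finFieldType), (qpolyC h : {rmorphism F -> {poly %/ h with hI}}).
by rewrite card_qfpoly sz.
Qed.

(** * The Frobenius automorphism of the quadratic extension *)

(** The embedding [iota] is an argument so that the ring morphism structure, for
    which [#|F|] must be a power of the characteristic of [L], can be inferred. *)
Definition frob (F L : finFieldType) (iota : {rmorphism F -> L}) (e : L) : L := e ^+ #|F|.

Section Frobenius.
Variables (F L : finFieldType) (iota : {rmorphism F -> L}).

Lemma frob_is_zmod_morphism : zmod_morphism (frob iota).
Proof.
have [p p_prime pF] := finPcharP F.
have pL : p \in [pchar L].
  by move: pF; rewrite !inE -(rmorph_nat iota) => /andP[-> /eqP->]; rewrite rmorph0 eqxx.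
have qp : [pchar L].-nat #|F|.
  have [n cardF] : exists n, #|F| = (p ^ n)%N.
    by exists (logn p #|F|); apply: card_pprimeChar.
  rewrite cardF pnatX; apply/orP; left.
  by rewrite (eq_pnat _ (pcharf_eq pL)) pnat_id.
move=> x y; rewrite /frob exprDn_pchar //.
by congr (_ + _); apply: (@exprNn_pchar L).
Qed.

Lemma frob_is_monoid_morphism : monoid_morphism (frob iota).
Proof. by split=> [|x y]; rewrite /frob ?expr1n ?exprMn. Qed.

HB.instance Definition _ :=
  GRing.isZmodMorphism.Build L L (frob iota) frob_is_zmod_morphism.
HB.instance Definition _ :=
  GRing.isMonoidMorphism.Build L L (frob iota) frob_is_monoid_morphism.

Lemma frobD x y : frob iota (x + y) = frob iota x + frob iota y.
Proof. exact: rmorphD. Qed.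

Lemma frobN x : frob iota (- x) = - frob iota x. Proof. exact: rmorphN. Qed.

Lemma frobM x y : frob iota (x * y) = frob iota x * frob iota y.
Proof. exact: rmorphM. Qed.

Lemma frobV x : frob iota x^-1 = (frob iota x)^-1. Proof. exact: fmorphV. Qed.

Lemma frob1 : frob iota 1 = 1. Proof. exact: rmorph1. Qed.

(** The fixed points are the [q] roots of [X ^ q - X], which all lie in [F]. *)
Lemma frob_fixed e : frob iota e = e -> exists c, e = iota c.
Proof.
move=> efix; have := congr1 (fun r => (map_poly iota r).[e]) (finField_genPoly F).
rewrite rmorphB /= map_polyXn map_polyX rmorph_prod hornerD hornerN hornerXn hornerX.
rewrite -[e ^+ _]/(frob iota e) efix subrr horner_prod => /esym/eqP/prodf_eq0[c _].
by rewrite rmorphB /= map_polyX map_polyC /= hornerXsubC subr_eq0 => /eqP; exists c.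
Qed.

Hypothesis cardL : #|L| = (#|F| ^ 2)%N.

Lemma frobK e : frob iota (frob iota e) = e.
Proof. by rewrite /frob -exprM mulnn -cardL expf_card. Qed.

(** If [c = g ^ i] is fixed by Frobenius then [i] is a multiple of [q + 1], and
    [g ^ (i / (q + 1))] has norm [c]. *)
Lemma norm_surjective c : frob iota c = c -> exists b, b * frob iota b = c.
Proof.
have [->|c0 cfix] := eqVneq c 0; first by exists 0; rewrite mul0r.
have [g [g0 ggen gord]] := finField_generator L.
have [i ci] := ggen c c0.
have q0 : (0 < #|F|)%N by apply/card_gt0P; exists 0.
have : (#|F|.+1 %| i)%N.
  have : g ^+ (i * #|F|.-1) == 1.
    rewrite exprM -ci; apply/eqP/(mulfI c0).
    by rewrite -exprS prednK // mulr1.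
  have q1 := finNzRing_gt1 F.
  rewrite gord cardL.
  have -> : (#|F| ^ 2).-1 = (#|F|.+1 * #|F|.-1)%N by nia.
  by rewrite dvdn_pmul2r // -subn1 subn_gt0.
case/dvdnP=> j ij; exists (g ^+ j).
by rewrite /frob -exprS -exprM ci ij.
Qed.

(** For a generator [g] of [L^*], the element [g ^ (q - 1)] has order [q + 1].
    The square root that is taken has norm [g ^ ((q ^ 2 - 1) / 2) = -1] for odd
    [q]; for even [q] it is a power of [g ^ (q - 1)], of norm [1 = -1]. *)
Lemma norm_m1_sqr_order : exists th : L, th * frob iota th = -1 /\
  (forall m n, ((th ^+ 2) ^+ m == (th ^+ 2) ^+ n) = (m == n %[mod #|F|.+1])).
Proof.
have [g [g0 ggen gord]] := finField_generator L.
have q1 := finNzRing_gt1 F.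
have qL : (#|L|.-1 = #|F|.-1 * #|F|.+1)%N by rewrite cardL; nia.
have om m n : ((g ^+ #|F|.-1) ^+ m == (g ^+ #|F|.-1) ^+ n) = (m == n %[mod #|F|.+1]).
  wlog mn : m n / (m <= n)%N.
    by move=> W; case/orP: (leq_total m n) => /W //; rewrite eq_sym => ->; rewrite eq_sym.
  rewrite [RHS]eq_sym (eqn_mod_dvd _ mn) -{1}(subnKC mn) exprD.
  rewrite -[X in X == _]mulr1 (inj_eq (mulfI _)) ?expf_neq0 //.
  by rewrite eq_sym -exprM gord qL dvdn_pmul2l // -subn1 subn_gt0.
suff [th [th2 thN]] : exists th, th ^+ 2 = g ^+ #|F|.-1 /\ th * frob iota th = -1.
  by exists th; rewrite th2.
have [q_odd|q_even] := boolP (odd #|F|).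
  have qh : (#|F|.-1 = #|F|.-1./2 * 2)%N by lia.
  exists (g ^+ #|F|.-1./2); split.
    by rewrite -exprM -qh.
  rewrite /frob -exprS -exprM.
  have : (g ^+ (#|F|.-1./2 * #|F|.+1)) ^+ 2 == 1.
    by rewrite -exprM gord qL mulnAC -qh.
  rewrite sqrf_eq1 gord qL dvdn_pmul2r // => /orP[/dvdn_leq h|/eqP//].
  by move: h q1 qh; set n := #|F|; clearbody n; lia.
exists (g ^+ (#|F|.-1 * (#|F|.+2)./2)); split.
  rewrite -exprM -mulnA.
  have -> : ((#|F|.+2)./2 * 2 = #|F|.+1 + 1)%N by lia.
  by rewrite mulnDr muln1 exprD -qL (eqP (_ : g ^+ #|L|.-1 == 1)) ?mul1r // gord.
have -> : -1 = 1 :> L.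
  have [p p_prime pF] := finPcharP F.
  have two : (2%:R : F) == 0.
    rewrite -(dvdn_pcharf pF); have /prime_nt_dvdP : prime 2 := isT.
    have cardF : #|F| = (p ^ (logn p #|F|))%N by apply: card_pprimeChar.
    have : ~~ odd p by move: q_even; rewrite cardF oddX negb_or => /andP[].
    by case/even_prime: p_prime => [->|->].
  apply/eqP; rewrite -subr_eq0 -opprD oppr_eq0 -[1 + 1]/(2%:R) -(rmorph_nat iota).
  by rewrite (eqP two) rmorph0.
rewrite /frob -exprS -exprM; apply/eqP; rewrite gord qL.
by rewrite mulnAC dvdn_mulr.
Qed.

End Frobenius.

(** * Matrices over F in hermitian form over L *)
Section HermitianModel.
Variables (F L : finFieldType) (iota : {rmorphism F -> L}).
Hypothesis cardL : #|L| = (#|F| ^ 2)%N.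


Lemma frob_not_identity : exists l : L, l != frob iota l.
Proof.
have [g [g0 _ gord]] := finField_generator L.
exists g; rewrite eq_sym /frob -[X in _ == X]mulr1 -(prednK (_ : 0 < #|F|)%N); last first.
  by apply/card_gt0P; exists 0.
rewrite exprS (inj_eq (mulfI g0)) gord cardL.
have q1 := finNzRing_gt1 F; apply/negP => /dvdn_leq.
by move: q1; set q := #|F|; clearbody q; nia.
Qed.

Variable l : L.
Hypothesis l_moved : l != frob iota l.
Local Notation D := (frob iota l - l).

(** Conjugation by [fromL] diagonalises the action of [F[l] = L] on itself: its
    columns are exchanged by Frobenius, so matrices over [F] become the matrices
    of the shape [(a, b; b^q, a^q)]. *)
Definition fromL : 'M[L]_2 := mx2 1 1 l (frob iota l).
Definition toL : 'M[L]_2 := mx2 (frob iota l / D) (- D^-1) (- l / D) (D^-1).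
Definition herm (A : 'M[F]_2) : 'M[L]_2 := toL *m map_mx iota A *m fromL.

Lemma D_neq0 : D != 0. Proof. by rewrite subr_eq0 eq_sym. Qed.

Lemma fromL_toL : fromL *m toL = 1%:M.
Proof. by have D0 := D_neq0; rewrite mul_mx2 scalar_mx2; congr mx2; field. Qed.

Lemma toL_fromL : toL *m fromL = 1%:M.
Proof. exact: mulmx1C fromL_toL. Qed.

Lemma hermM A B : herm (A *m B) = herm A *m herm B.
Proof. by rewrite /herm map_mxM !mulmxA -[_ *m fromL *m toL]mulmxA fromL_toL mulmx1. Qed.

Lemma herm_scalar c : herm c%:M = (iota c)%:M.
Proof. by rewrite /herm map_scalar_mx mul_mx_scalar -scalemxAl toL_fromL scalemx1. Qed.

Lemma herm_inj : injective herm.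
Proof.
move=> A B /(congr1 (fun M => fromL *m M *m toL)).
rewrite /herm !mulmxA fromL_toL !mul1mx -!mulmxA fromL_toL !mulmx1.
by move=> /matrixP e; apply/matrixP => i j; have := e i j; rewrite !mxE => /fmorph_inj.
Qed.

Lemma det_herm A : iota (\det A) = \det (herm A).
Proof.
by rewrite /herm !det_mulmx det_map_mx mulrC mulrA -det_mulmx fromL_toL det1 mul1r.
Qed.

Lemma tr_herm A : iota (\tr A) = \tr (herm A).
Proof. by rewrite /herm mxtrace_mulC mulmxA fromL_toL mul1mx trace_map_mx. Qed.

Lemma herm_scalar_mx A : is_scalar_mx A -> is_scalar_mx (herm A).
Proof. by case/is_scalar_mxP=> c ->; rewrite herm_scalar scalar_mx_is_scalar. Qed.

Lemma frob_fixed_mx (M : 'M[L]_2) : (forall i j, frob iota (M i j) = M i j) ->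
  exists A, map_mx iota A = M.
Proof.
move=> fixM; have ex i j := frob_fixed (fixM i j).
have [c00 e00] := ex 0 0; have [c01 e01] := ex 0 1.
have [c10 e10] := ex 1 0; have [c11 e11] := ex 1 1.
exists (mx2 c00 c01 c10 c11); rewrite [RHS]mx2P [LHS]mx2P !mxE /=.
by rewrite e00 e01 e10 e11.
Qed.

(** Frobenius exchanges the columns of [fromL], the rows of [toL], and both the
    rows and the columns of a matrix of this shape; so it fixes the entries of
    the conjugate. *)
Lemma herm_surj a b : exists A, herm A = mx2 a b (frob iota b) (frob iota a).
Proof.
have D0 := D_neq0.
pose M := fromL *m mx2 a b (frob iota b) (frob iota a) *m toL.
have fixM i j : frob iota (M i j) = M i j.
  move: i j; have D0' : l - frob iota l != 0 by rewrite subr_eq0.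
  apply: (@mx2_entries _ (fun e => frob iota e = e) M); rewrite /M !mul_mx2 !mxE /=;
    rewrite !(frobD, frobM, frobN, frobV, frob1, frobK iota cardL);
    by field; rewrite ?D0 ?D0'.
have [A AM] := frob_fixed_mx fixM.
exists A; rewrite /herm AM /M !mulmxA toL_fromL mul1mx -mulmxA toL_fromL.
by rewrite mulmx1.
Qed.

End HermitianModel.

(** * The nonsplit triple *)
Lemma card_SL2_le (F : finFieldType) : (#|SL2 F| <= #|F| * #|F|.-1 * #|F|.+1)%N.
Proof.
have q1 := finNzRing_gt1 F; have q0 : (0 < #|F|.-1)%N by rewrite -subn1 subn_gt0.
pose dmx (u : {unit F}) : 'M[F]_2 := mx2 (val u) 0 0 1.
have detd u : \det (dmx u) = val u by rewrite det_mx2; ring.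
pose d (u : {unit F}) : {'GL_2[F]} := insubd (1%g : {'GL_2[F]}) (dmx u).
have dE u : GLval (d u) = dmx u.
  by apply: (@insubdK _ _ {'GL_2[F]}); rewrite unfold_in /= unitmxE detd; apply: (valP u).
pose f (gu : {'GL_2[F]} * {unit F}) := (gu.1 * d gu.2)%g.
have f_inj : {in setX (SL2 F) [set: {unit F}] &, injective f}.
  move=> [g u] [h v] /setXP[gSL _] /setXP[hSL _] /= /(congr1 (@GLval 2 F)).
  rewrite !GL_MxE !dE => e.
  have uv : u = v.
    by apply: val_inj; have := congr1 determinant e; rewrite !det_mulmx !SL_det // !detd !mul1r.
  congr pair => //; apply: GLval_inj; apply: (can_inj (mulmxK (_ : dmx u \in unitmx))).
    by rewrite unitmxE detd; apply: (valP u).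
  by rewrite e uv.
rewrite -(leq_pmul2r q0) -{1}card_finField_unit -cardsX -(card_in_imset f_inj).
apply: leq_trans (max_card _) _; rewrite -cardsT card_GL_2.
by apply: eq_leq; move: #|F| #|F|.-1 #|F|.+1 => m n r; ring.
Qed.

Lemma double_mod_inj q i j : (i < half_if_odd q q.+1)%N -> (j < half_if_odd q q.+1)%N ->
  (2 * i == 2 * j %[mod q.+1])%N -> i = j.
Proof.
wlog ij : i j / (i <= j)%N.
  move=> W; case/orP: (leq_total i j) => ij iq jq e; first exact: W.
  by symmetry; apply: (W j i ij jq iq); rewrite eq_sym.
rewrite /half_if_odd => iq jq; rewrite eq_sym eqn_mod_dvd ?leq_mul2l // -mulnBr.
case: ifP iq jq => q_odd iq jq.
  rewrite -(even_halfK (_ : ~~ odd q.+1)) /= ?q_odd // -mul2n dvdn_pmul2l //.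
  by case: (posnP (j - i)) => [|h /(dvdn_leq h)]; move: iq jq ij; clear; lia.
rewrite Gauss_dvdr; last by rewrite coprimen2 /= q_odd.
by case: (posnP (j - i)) => [|h /(dvdn_leq h)]; move: iq jq ij; clear; lia.
Qed.

Lemma half_mod_inj q i j : (i <= q.+1./2)%N -> (j <= q.+1./2)%N ->
  (i == j %[mod q.+1])%N || (i + j == 0 %[mod q.+1])%N -> i = j.
Proof.
case: q => [|q]; first by case: i j => [|i] [|j].
move=> iq jq /orP[|].
  by rewrite !modn_small => [/eqP//| |]; move: iq jq; clear; lia.
rewrite mod0n => /dvdnP[m]; move: iq jq; clear.
by case: m => [|[|m]]; nia.
Qed.

(** The double cosets met by the words below have [(q + 1) * half_if_odd q (q + 1)]
    elements each, and [g] counts them. *)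
Lemma index_bound q g m r : (5 < q)%N -> (q.+1./2.-1 <= g)%N ->
  (g * q.+1 * half_if_odd q q.+1 <= m)%N -> (m * r <= q * q.-1 * q.+1)%N -> (r <= 3)%N.
Proof.
move=> q5 gn gm mr; rewrite leqNgt; apply/negP => r4.
have m4 : (m * 4 <= q * q.-1 * q.+1)%N by apply: leq_trans mr; rewrite leq_mul2l r4 orbT.
suff : (q * q.-1 < 4 * q.+1./2.-1 * half_if_odd q q.+1)%N.
  rewrite ltnNge => /negP; apply; rewrite -(leq_pmul2r (ltn0Sn q)).
  apply: leq_trans m4; rewrite (mulnC m) -!mulnA leq_mul2l /=.
  apply: leq_trans gm; rewrite -mulnA leq_mul // mulnC //.
rewrite /half_if_odd; move: q5; clear.
have [q_odd|q_even] := boolP (odd q).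
  have [h ->] : exists h, q = h.*2.+1 by exists q./2; lia.
  have -> : (h.*2.+2)./2 = h.+1 by lia.
  by rewrite -muln2 /=; nia.
have [h ->] : exists h, q = h.*2 by exists q./2; lia.
have -> : (h.*2.+1)./2 = h by lia.
by rewrite -muln2; nia.
Qed.

Section NonsplitTriple.
Variables (F L : finFieldType) (iota : {rmorphism F -> L}) (l th : L).
Hypotheses (cardL : #|L| = (#|F| ^ 2)%N) (l_moved : l != frob iota l).
Hypotheses (q_gt5 : (5 < #|F|)%N) (thN : th * frob iota th = -1).
Local Notation om := (th ^+ 2).
Hypothesis omX : forall m n, (om ^+ m == om ^+ n) = (m == n %[mod #|F|.+1]).
Local Notation q := #|F|.
Local Notation SL := (SL2 F).
Local Notation Z := (pmI F).
Implicit Types g h : {'GL_2[F]}.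

Let hg g := herm iota l (GLval g).

Let th0 : th != 0.
Proof. by apply: contra_eq_neq thN => ->; rewrite mul0r eq_sym oppr_eq0 oner_eq0. Qed.

Let om0 : om != 0. Proof. by rewrite expf_neq0. Qed.

Let frob_th : frob iota th = - th^-1.
Proof. by apply: (mulfI th0); rewrite thN mulrN mulfV. Qed.

Let om_neq1 n : (0 < n <= 6)%N -> om ^+ n != 1.
Proof.
case/andP=> n0 n6; rewrite -(expr0 om) omX mod0n.
by apply/negP => /(dvdn_leq n0); rewrite leqNgt ltnS (leq_trans n6).
Qed.

Definition nonsplit_trace : L := om + om^-1.
Definition nonsplit_scale : L := nonsplit_trace / (th - th^-1).
Local Notation tau := nonsplit_trace.
Local Notation s := nonsplit_scale.

Let thV0 : th - th^-1 != 0.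
Proof.
apply: contra (@om_neq1 1 isT) => /eqP e; rewrite expr1.
have -> : om = 1 + th * (th - th^-1) by field.
by rewrite e mulr0 addr0.
Qed.

Let tau0 : tau != 0.
Proof.
apply: contra (@om_neq1 4 isT) => /eqP e.
have -> : om ^+ 4 = 1 + om * (om ^+ 2 - 1) * tau by rewrite /nonsplit_trace; field.
by rewrite e mulr0 addr0.
Qed.

Let s0 : s != 0.
Proof. by rewrite mulf_neq0 ?invr_eq0. Qed.

Let frob_s : frob iota s = s.
Proof.
rewrite /nonsplit_scale /nonsplit_trace expr2.
rewrite !(frobD, frobM, frobN, frobV) frob_th.
have om1 : 1 + - th * th != 0.
  by rewrite mulNr subr_eq0 eq_sym -expr2 -(expr1 om) om_neq1.
have om2 : om - 1 != 0 by rewrite subr_eq0 -(expr1 om) om_neq1.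
by field; rewrite ?th0 ?om1 ?om2 ?oppr_eq0 ?oner_eq0.
Qed.

Let s2 : s ^+ 2 + 1 != 0.
Proof.
have e : (s ^+ 2 + 1) * (th - th^-1) ^+ 2 = (tau - 1) * (tau + 2%:R).
  rewrite /nonsplit_scale mulrDl mul1r exprMn exprVn mulfVK ?expf_neq0 //.
  by rewrite /nonsplit_trace; field.
suff : (tau - 1) * (tau + 2%:R) != 0 by rewrite -e mulf_eq0 => /norP[].
rewrite mulf_neq0 //.
  apply: contra (@om_neq1 6 isT) => /eqP e1.
  have -> : om ^+ 6 = 1 + om * (om ^+ 3 - 1) * (om + 1) * (tau - 1).
    by rewrite /nonsplit_trace; field.
  by rewrite e1 mulr0 addr0.
apply: contra (@om_neq1 2 isT) => /eqP e1.
have : (om + 1) ^+ 2 == 0.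
  have -> : (om + 1) ^+ 2 = om * (tau + 2%:R) by rewrite /nonsplit_trace; field.
  by rewrite e1 mulr0.
by rewrite sqrf_eq0 addr_eq0 => /eqP->; rewrite sqrrN expr1n.
Qed.

Let hgM g h : hg (g * h)%g = hg g *m hg h.
Proof. by rewrite /hg GL_MxE hermM. Qed.

Let hg_det g : g \in SL -> \det (hg g) = 1.
Proof. by move=> gSL; rewrite /hg -det_herm // SL_det // rmorph1. Qed.

Let hg1 : hg 1%g = 1%:M.
Proof. by rewrite /hg GL_1E herm_scalar // rmorph1. Qed.

Let hgV g a b c d : g \in SL -> hg g = mx2 a b c d -> hg (g^-1)%g = mx2 d (- b) (- c) a.
Proof.
move=> gSL e; have := hg_det gSL; rewrite e det_mx2 => dg.
have gX : hg g *m mx2 d (- b) (- c) a = 1%:M.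
  by rewrite e mul_mx2 scalar_mx2 -dg; congr mx2; ring.
by rewrite -[LHS]mulmx1 -gX mulmxA -hgM mulVg hg1 mul1mx.
Qed.

(** The matrix [x] has trace [s (th - 1 / th)], which is the trace of [y] by the
    choice of [s], and [x y] has the opposite trace; [b] makes its determinant
    equal to 1. *)
Lemma nonsplit_pair_exists : exists (x y : {'GL_2[F]}) (b : L),
  [/\ x \in SL, y \in SL, herm iota l (GLval y) = mx2 om 0 0 om^-1,
      herm iota l (GLval x) = mx2 (- (s / th)) b (frob iota b) (s * th)
    & b * frob iota b = - (s ^+ 2) - 1].
Proof.
have [|b bN] := @norm_surjective F L iota cardL (- s ^+ 2 - 1).
  by rewrite !(frobD, frobN, frob1) expr2 frobM frob_s.
have [A hA] := herm_surj cardL l_moved om 0.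
have [B hB] := herm_surj cardL l_moved (- (s / th)) b.
have f0 : frob iota 0 = 0 by rewrite rmorph0.
have fom : frob iota om = om^-1 by rewrite expr2 frobM frob_th mulrNN -invfM -expr2.
have fs : frob iota (- (s / th)) = s * th.
  by rewrite frobN frobM frobV frob_s frob_th invrN invrK mulrN opprK.
rewrite f0 fom in hA; rewrite fs in hB.
have dA : \det A = 1.
  apply: (fmorph_inj iota); rewrite (det_herm l_moved) hA det_mx2 rmorph1.
  by rewrite mulfV // mul0r subr0.
have dB : \det B = 1.
  apply: (fmorph_inj iota); rewrite (det_herm l_moved) hB det_mx2 rmorph1 bN.
  by field; rewrite ?th0.
by exists (glmx B), (glmx A), b; split; rewrite ?glmx_SL ?glmxE.
Qed.

Variables (x y : {'GL_2[F]}) (b : L).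
Hypotheses (xSL : x \in SL) (ySL : y \in SL).
Hypothesis hy : hg y = mx2 om 0 0 om^-1.
Hypothesis hx : hg x = mx2 (- (s / th)) b (frob iota b) (s * th).
Hypothesis bN : b * frob iota b = - (s ^+ 2) - 1.

Let b0 : b != 0.
Proof. by apply: contra_eq_neq bN => ->; rewrite mul0r eq_sym -opprD oppr_eq0. Qed.

Let b'E : frob iota b = (- (s ^+ 2) - 1) / b.
Proof. by rewrite -bN mulrC mulKf. Qed.

Let hyX n : hg (y ^+ n)%g = mx2 (om ^+ n) 0 0 (om ^+ n)^-1.
Proof.
elim: n => [|n IH]; first by rewrite expg0 hg1 scalar_mx2 expr0 invr1.
rewrite expgS hgM IH hy mul_mx2 !mulr0 !mul0r !addr0 !add0r.
by rewrite (exprS om) (invfM om).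
Qed.

(** The norm of the upper left entry of [x]. *)
Let nu := - s ^+ 2.
Let modulus (k : nat) := nu ^+ 2 + (nu - 1) ^+ 2 - nu * (nu - 1) * (om ^+ k + (om ^+ k)^-1).
(** The words [x y^i x^-1] for [k = 2 i] and [x y^i x] for [k = 2 i - 1].  Because
    the upper left entry of [x] is [- s / th] with [th ^ 2 = om], both families
    obey the same formula in [k]. *)
Let word (k : nat) : {'GL_2[F]} := (x * y ^+ uphalf k * (if odd k then x else x^-1))%g.

Let word_modulus k : hg (word k) 0 0 * hg (word k) 1 1 = modulus k.
Proof.
have hxV := hgV xSL hx.
rewrite /word !hgM hyX hx; set o := om ^+ uphalf k.
have o0 : o != 0 by rewrite expf_neq0.
rewrite /modulus /nu; case: ifP => k_odd.
  rewrite hx !mul_mx2 !mxE /= b'E.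
  have -> : om ^+ k = o ^+ 2 / om.
    apply: (mulIf om0); rewrite divfK // /o -(exprM om) -(exprSr om); congr (_ ^+ _).
    by rewrite muln2 -[in LHS](odd_double_half k) k_odd uphalf_half k_odd doubleD.
  by field; rewrite ?o0 ?th0 ?b0.
rewrite hxV !mul_mx2 !mxE /= b'E.
have -> : om ^+ k = o ^+ 2.
  by rewrite /o -(exprM om) muln2 uphalf_half k_odd add0n even_halfK ?k_odd.
by field; rewrite ?o0 ?th0 ?b0.
Qed.

Let nu0 : nu != 0. Proof. by rewrite oppr_eq0 expf_neq0. Qed.
Let nu1 : nu - 1 != 0. Proof. by rewrite -opprD oppr_eq0. Qed.

(** The function [k => om^k + om^-k] takes each value at most twice on a period,
    at [k] and [- k]. *)
Let modulus_inj i j : (i <= q.+1./2)%N -> (j <= q.+1./2)%N -> modulus i = modulus j -> i = j.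
Proof.
move=> iq jq e; apply: (half_mod_inj iq jq); rewrite -!omX expr0.
have : nu * (nu - 1) * ((om ^+ i - om ^+ j) * (om ^+ (i + j) - 1)) == 0.
  have -> : nu * (nu - 1) * ((om ^+ i - om ^+ j) * (om ^+ (i + j) - 1)) =
      om ^+ (i + j) * (modulus j - modulus i).
    rewrite /modulus exprD; have [oi oj] : om ^+ i != 0 /\ om ^+ j != 0.
      by rewrite !expf_neq0.
    by field; rewrite -?exprM ?expf_neq0.
  by rewrite e subrr mulr0.
by rewrite !mulf_eq0 (negPf nu0) (negPf nu1) /= !subr_eq0.
Qed.

Let modulus0 : modulus 0 = 1.
Proof. by rewrite /modulus expr0 invr1; ring. Qed.


(** The elements of the double cosets of the words [1 <= k <= (q + 1) / 2], left
    and right multiplied by powers of [y]; the right exponents stay below half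
    of [q + 1] when [q] is odd because [-1] belongs to [<y>]. *)
Let elt (t : 'I_(q.+1./2) * 'I_q.+1 * 'I_(half_if_odd q q.+1)) :=
  (y ^+ t.1.2 * word t.1.1.+1 * y ^+ t.2)%g.

(** For a word of modulus 0 the upper left entry vanishes and its double coset
    is a single coset; modulus 1, attained at [k = 0], has the same defect. *)
Let good := [set k : 'I_(q.+1./2) | modulus k.+1 != 0].

Let card_good : (q.+1./2.-1 <= #|good|)%N.
Proof.
have : (#|~: good| <= 1)%N.
  apply/card_le1_eqP => i j; rewrite !inE !negbK => /eqP ei /eqP ej.
  by apply: val_inj; apply: succn_inj; apply: modulus_inj; rewrite ?ltn_ord // ei ej.
by have := cardsC good; rewrite card_ord; clear; lia.
Qed.

Let word_SL k : word k \in SL.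
Proof. by rewrite /word; case: ifP; rewrite !memGL_M ?memGL_V ?memGL_X. Qed.

(** The product of the diagonal entries determines [k]; then the two entries of
    the first row, both nonzero, determine the product and the quotient of the
    powers of [om] on either side. *)
Let elt_inj : {in setX (setX good [set: 'I_q.+1]) [set: 'I_(half_if_odd q q.+1)] &,
  injective elt}.
Proof.
move=> [[k i] j] [[k' i'] j'] /setXP[/setXP[/= kg _] _] /setXP[/setXP[/= k'g _] _] /=.
move=> /(congr1 hg); rewrite /elt /=.
rewrite (hgM (y ^+ i * _)%g) (hgM (y ^+ i' * _)%g) (hgM (y ^+ i)%g) (hgM (y ^+ i')%g) !hyX.
move: (word_modulus k.+1) (word_modulus k'.+1) (hg_det (word_SL k.+1)).
rewrite {3 4}(mx2P (hg (word k.+1))) {3}(mx2P (hg (word k'.+1))).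
set A := hg (word k.+1) 0 0; set B := hg (word k.+1) 0 1.
set C := hg (word k.+1) 1 0; set D := hg (word k.+1) 1 1.
set A' := hg (word k'.+1) 0 0; set B' := hg (word k'.+1) 0 1.
set C' := hg (word k'.+1) 1 0; set D' := hg (word k'.+1) 1 1.
rewrite det_mx2 => mk mk' dk.
have AD0 : A * D != 0 by rewrite mk; move: kg; rewrite inE.
have AD1 : A * D != 1.
  rewrite mk -modulus0; apply/eqP => /modulus_inj.
  by move=> /(_ (ltn_ord k) isT).
have B0 : B != 0.
  by apply: contra AD1 => /eqP B0; rewrite B0 mul0r subr0 in dk; rewrite dk.
have A0 : A != 0 by move: AD0; rewrite mulf_eq0 => /norP[].
have powN0 n : om ^+ n != 0 by rewrite expf_neq0.
rewrite !mul_mx2 !mulr0 !mul0r !addr0 !add0r => /mx2_inj[e00 e01 _ e11].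
have kk' : k = k'.
  apply: val_inj; apply: succn_inj; apply: modulus_inj; rewrite ?ltn_ord //.
  rewrite -mk -mk'.
  have phase (u v a d : L) : u != 0 -> v != 0 -> a * d = (u * a * v) * (u^-1 * d * v^-1).
    by move=> u0 v0; field; rewrite ?u0 ?v0.
  by rewrite (phase (om ^+ i) (om ^+ j) A D) // e00 e11 -phase.
have AA : A = A' by rewrite /A /A' kk'.
have BB : B = B' by rewrite /B /B' kk'.
rewrite -AA -BB in e00 e01.
have e1 : om ^+ i * om ^+ j = om ^+ i' * om ^+ j'.
  by apply: (mulIf A0); rewrite mulrAC e00 mulrAC.
have e2 : om ^+ i / om ^+ j = om ^+ i' / om ^+ j'.
  by apply: (mulIf B0); rewrite mulrAC e01 mulrAC.
have jj : j = j'.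
  apply: val_inj; apply: (double_mod_inj (ltn_ord j) (ltn_ord j')).
  rewrite -omX !(mulnC 2) !(exprM om).
  have sq (a c : L) : c != 0 -> a != 0 -> c ^+ 2 = (a * c) / (a / c).
    by move=> c0 a0; field; rewrite ?c0 ?a0.
  rewrite (sq (om ^+ i) (om ^+ j)) // (sq (om ^+ i') (om ^+ j')) //.
  by rewrite e1 e2.
have ii : i = i'.
  apply: val_inj => /=; rewrite jj in e1; move: e1 => /(mulIf (powN0 j')) /eqP.
  by rewrite omX !modn_small // => /eqP.
by rewrite kk' ii jj.
Qed.

(** At least [(q + 1) / 2 - 1] words have nonzero modulus, and each contributes a
    full double coset to the subgroup generated by [x] and [y]. *)
Let nonsplit_index_le3 : (#|SL2 F : <<[set x; y]>>%g| <= 3)%N.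
Proof.
set H := <<[set x; y]>>%G.
have xH : x \in H by rewrite mem_gen // !inE eqxx.
have yH : y \in H by rewrite mem_gen // !inE eqxx orbT.
have H_SL : H \subset SL2 F.
  rewrite gen_subG; apply/subsetP => g; rewrite !inE.
  by case/orP=> /eqP->; [move: xSL|move: ySL]; rewrite inE.
have elt_H t : elt t \in H.
  by rewrite /elt /word; case: ifP; rewrite !memGL_M ?memGL_V ?memGL_X.
have : (#|setX (setX good [set: 'I_q.+1]) [set: 'I_(half_if_odd q q.+1)]| <= #|H|)%N.
  rewrite -(card_in_imset elt_inj); apply/subset_leq_card/subsetP => _ /imsetP[t _ ->].
  exact: elt_H.
rewrite !cardsX !cardsT !card_ord => leH.
apply: index_bound q_gt5 card_good leH _.
by rewrite Lagrange // card_SL2_le.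
Qed.


Lemma nonsplit_gen :
  (6%:R != 0 :> F) || [exists a : F, (a != 0) && (a ^+ 12 != 1)] ->
  SL \subset <<[set x; y]>>%g.
Proof.
move=> hF; apply: (@SL_expg6 _ <<[set x; y]>>%G hF) => g gSL.
exact: (index_le3_expg6 nonsplit_index_le3 gSL).
Qed.

Let hg_sign g : (GLval g == 1) || (GLval g == -1) = (hg g == 1%:M) || (hg g == (-1)%:M).
Proof.
have m1 : -1 = (-1)%:M :> 'M[F]_2 by rewrite raddfN.
have key c : (GLval g == c%:M) = (hg g == (iota c)%:M).
  by rewrite /hg -(herm_scalar l_moved) (inj_eq (herm_inj l_moved)).
by rewrite m1 !key rmorphN rmorph1.
Qed.

Lemma nonsplit_order_y :
  (#[coset Z y]%g %| half_if_odd q q.+1)%N /\ (4 <= #[coset Z y]%g)%N.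
Proof.
have yX n : ((coset Z y ^+ n)%g == 1%g) = (om ^+ n == 1) || (om ^+ n == -1).
  rewrite coset_expr_eq1 // -GLvalX hg_sign hyX.
  have key (c : L) : c * c = 1 -> (mx2 (om ^+ n) 0 0 (om ^+ n)^-1 == c%:M) = (om ^+ n == c).
    move=> cc; rewrite scalar_mx2; apply/eqP/eqP => [/mx2_inj[]//|->].
    congr mx2; rewrite -[LHS]mulr1 -cc mulKf //.
    by apply: contraTneq (oner_neq0 L) => c0; rewrite -cc c0 mul0r eqxx.
  by rewrite !key ?mulrNN ?mul1r.
have omX1 n : (om ^+ n == 1) = (q.+1 %| n)%N by rewrite -(expr0 om) omX mod0n.
split.
  rewrite order_dvdn yX /half_if_odd; case: ifP => q_odd; last by rewrite omX1 dvdnn.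
  rewrite -eqf_sqr expr1n -(exprM om) omX1 muln2 even_halfK ?dvdnn //=.
  by rewrite q_odd.
have := expg_order (coset Z y) => /eqP; rewrite yX -eqf_sqr expr1n -(exprM om) omX1.
move=> /dvdn_leq; rewrite muln_gt0 order_gt0 => /(_ isT).
by move: q_gt5; move: #[_]%g q => m n; clear; lia.
Qed.

Lemma nonsplit_orders :
  #[coset Z x]%g = #[coset Z y]%g /\ #[coset Z (x * y)%g]%g = #[coset Z y]%g.
Proof.
have nonscalar g : ~~ is_scalar_mx (hg g) -> ~~ is_scalar_mx (GLval g).
  by apply: contra => /herm_scalar_mx; apply.
have ny : ~~ is_scalar_mx (GLval y).
  apply: nonscalar; rewrite hy scalar_mx2E eqxx /=.
  apply: contra (@om_neq1 2 isT) => /eqP e.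
  by rewrite (expr2 om) {1}e mulVf.
have tr_y : iota (\tr (GLval y)) = tau.
  by rewrite (tr_herm l_moved) -/(hg y) hy tr_mx2.
split; apply: order_coset_trace => //; rewrite ?memGL_M //.
- by apply: nonscalar; rewrite hx scalar_mx2E (negPf b0).
- left; apply: (fmorph_inj iota); rewrite tr_y (tr_herm l_moved) -/(hg x) hx tr_mx2.
  rewrite -[RHS](divfK thV0) -/s; field.
  by rewrite ?th0.
- apply: nonscalar; rewrite hgM hx hy mul_mx2 scalar_mx2E.
  by rewrite !mulr0 !add0r mulf_eq0 (negPf b0) invr_eq0 (negPf om0).
right; apply: (fmorph_inj iota); rewrite rmorphN /= tr_y.
rewrite (tr_herm l_moved) -/(hg (x * y)%g) hgM hx hy mul_mx2 tr_mx2.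
rewrite -[tau](divfK thV0) -/s; field.
by rewrite ?th0.
Qed.

End NonsplitTriple.

(** * The Beauville structure *)
Lemma coprime_powers_not_conjugate (gT : finGroupType) (a b g : gT) (m n i j : nat) :
  coprime m n -> (#[a]%g %| m)%N -> (#[b]%g %| n)%N -> (a ^+ i)%g != 1%g ->
  ((a ^+ i) ^ g)%g != (b ^+ j)%g.
Proof.
move=> cop am bn; apply: contraNneq => e; rewrite -order_eq1 -dvdn1 -(eqP cop).
rewrite dvdn_gcd (dvdn_trans (orderXdvd a i) am) -(orderJ _ g) e.
exact: dvdn_trans (orderXdvd b j) bn.
Qed.

(** The divisors [n - 1 > 4] of 12 leave [n = 7] and [n = 13], which are prime to
    6. *)
Lemma pred_ndvd12 p n : prime p -> (p %| 6)%N -> (p %| n)%N -> (5 < n)%N -> ~~ (n.-1 %| 12)%N.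
Proof.
move=> p_prime p6 pn n5; apply/negP => n12.
have p_le6 : (p <= 6)%N := @dvdn_leq p 6 isT p6.
have n_le13 : (n.-1 <= 12)%N := @dvdn_leq n.-1 12 isT n12.
have : n \in [:: 7; 13]%N.
  move: n5 n12 n_le13; clear.
  by do 14! [case: n => [|n] //].
move: p_prime p6 pn p_le6; rewrite !inE; case: p => [|[|[|[|[|[|[|//]]]]]]] //.
all: by move=> _ _ pn _ /orP[]/eqP e; rewrite e in pn.
Qed.

Section BeauvilleL2.
Variables (F : finFieldType) (p k : nat).
Hypotheses (p_prime : prime p) (cardF : #|F| = (p ^ k)%N) (q_gt5 : (5 < #|F|)%N).
Local Notation q := #|F|.
Local Notation SL := (SL2 F).
Local Notation Z := (pmI F).

(** In characteristic 2 or 3 a generator of [F^*] has order [q - 1], which does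
    not divide 12 for [q > 5]. *)
Lemma expr12_neq1 :
  (6%:R != 0 :> F) || [exists a : F, (a != 0) && (a ^+ 12 != 1)].
Proof.
have [six|//] := eqVneq (6%:R : F) 0; apply/existsP.
have pF := card_finPcharP cardF p_prime.
have p6 : (p %| 6)%N by rewrite (dvdn_pcharf pF) six.
have [a [a0 _ aord]] := finField_generator F; exists a; rewrite a0 aord /=.
have pq : (p %| q)%N by rewrite cardF dvdn_exp // (card_gt0_exp cardF q_gt5).
exact: pred_ndvd12 p_prime p6 pq q_gt5.
Qed.

Lemma nonsplit_triple : exists x y : {'GL_2[F]},
  [/\ x \in SL /\ y \in SL, SL \subset <<[set x; y]>>%g,
      #[coset Z x]%g%:R^-1 + #[coset Z y]%g%:R^-1 + #[coset Z (x * y)%g]%g%:R^-1 < 1 :> rat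
    & [/\ #[coset Z x]%g %| half_if_odd q q.+1, #[coset Z y]%g %| half_if_odd q q.+1
        & #[coset Z (x * y)%g]%g %| half_if_odd q q.+1]%N].
Proof.
have [L [iota cardL]] := quadratic_extension F.
have [l l_moved] := frob_not_identity iota cardL.
have [th [thN omX]] := norm_m1_sqr_order iota cardL.
have [x [y [b [xSL ySL hy hx bN]]]] := nonsplit_pair_exists cardL l_moved q_gt5 thN omX.
have gen := nonsplit_gen l_moved q_gt5 thN omX xSL ySL hy hx bN expr12_neq1.
have [oy oy4] := nonsplit_order_y l_moved q_gt5 omX ySL hy.
have [ox oxy] := nonsplit_orders l_moved q_gt5 thN omX xSL ySL hy hx bN.
exists x, y; rewrite ox oxy; split=> //.
exact: (sum_inv_lt1 oy4 oy4 oy4 sum_inv_444).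
Qed.

Lemma split_triple : exists x y : {'GL_2[F]},
  [/\ x \in SL /\ y \in SL, SL \subset <<[set x; y]>>%g,
      #[coset Z x]%g%:R^-1 + #[coset Z y]%g%:R^-1 + #[coset Z (x * y)%g]%g%:R^-1 < 1 :> rat
    & [/\ #[coset Z x]%g %| p * half_if_odd q q.-1, #[coset Z y]%g %| p * half_if_odd q q.-1
        & #[coset Z (x * y)%g]%g %| p * half_if_odd q q.-1]%N].
Proof.
have oq := odd_card cardF q_gt5; rewrite /half_if_odd oq.
have [p_odd|p_even] := boolP (odd p).
  have [x [y [SLxy gen sum [ox oy oxy]]]] := split_triple_odd p_prime cardF q_gt5 p_odd.
  by exists x, y; split=> //; split; [apply: dvdn_mulr|apply: dvdn_mull|apply: dvdn_mulr].
have [x [y [SLxy gen sum [ox oy oxy]]]] := split_triple_even p_prime cardF q_gt5 p_even.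
by exists x, y; split=> //; split; [apply: dvdn_mulr|apply: dvdn_mull|apply: dvdn_mull].
Qed.

Lemma coprime_torus_orders : coprime (half_if_odd q q.+1) (p * half_if_odd q q.-1).
Proof.
have q1 := finNzRing_gt1 F.
rewrite coprimeMr; apply/andP; split.
  have cqp : coprime q.+1 p.
    apply: (@coprime_dvdr p q q.+1); last by rewrite coprimeSn.
    by rewrite cardF dvdn_exp // (card_gt0_exp cardF q_gt5).
  apply: coprime_dvdl cqp; rewrite /half_if_odd; case: ifP => // q_odd.
  by rewrite -{2}(even_halfK (_ : ~~ odd q.+1)) /= ?q_odd // -muln2 dvdn_mulr.
rewrite /half_if_odd; case: ifP => q_odd.
  have -> : (q.+1./2 = q.-1./2.+1)%N by move: q1; move: q => n; clear; lia.
  exact: coprimeSn.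
have -> : (q.+1 = 2 + q.-1)%N by move: q1; move: q => n; clear; lia.
rewrite coprime_sym /coprime gcdnDr -/(coprime _ _) coprimen2.
by move: q1 q_odd; move: q => [//|n] _ /= /negbFE.
Qed.

Lemma L2_beauville : admits_beauville_structure (L2 F).
Proof.
have [x1 [y1 [[x1SL y1SL] gen1 sum1 [ox1 oy1 oz1]]]] := nonsplit_triple.
have [x2 [y2 [[x2SL y2SL] gen2 sum2 [ox2 oy2 oz2]]]] := split_triple.
exists (coset Z x1), (coset Z y1), (coset Z x1 * coset Z y1)^-1%g.
exists (coset Z x2), (coset Z y2), (coset Z x2 * coset Z y2)^-1%g.
have nsZ := pmI_normal F.
split; [exact: quotient_hyperbolic|exact: quotient_hyperbolic|].
move=> a b g i j aT bT _; apply: (coprime_powers_not_conjugate _ _ coprime_torus_orders).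
  move: aT; rewrite !inE -orbA => /or3P[]/eqP-> //.
  by rewrite (order_coset_invM nsZ).
move: bT; rewrite !inE -orbA => /or3P[]/eqP-> //.
by rewrite (order_coset_invM nsZ).
Qed.

End BeauvilleL2.

Theorem theorem2p2 (q p k : nat) (p_prime : prime p) (k_gt0 : (0 < k)%N)
    (q_def : q = (p ^ k)%N) (q_gt5 : (5 < q)%N)
    (F : finFieldType) (card_F : #|F| = q) :
  admits_beauville_structure (L2 F).
Proof. by apply: (@L2_beauville F p k); rewrite ?card_F. Qed.
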